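(* Let $\sigma>0$, $\mu\ge0$ be constants. Suppose that there exists a constant $\gamma\ge0$ such that for every $(f,g)\in X$ and every $d\in\Phi(f,g)$ the corresponding solution $u$ satisfies $\limsup_{t\to+\infty}\|u[t]\|_\infty\le\gamma\sup_{t\ge0}|d(t)|$. Define for each $\omega>0$ $$r:=\frac{\omega\sqrt{(\mu\sigma-1)^2\omega^2+(\mu+\sigma\omega^2)^2}}{1+\sigma^2\omega^2},\qquad a:=\sqrt r\cos(\theta/2),\qquad b:=\sqrt r\sin(\theta/2),$$ where $\theta\in(0,\pi)$ is the unique angle that satisfies $$\cos(\theta)=\frac{(\mu\sigma-1)\omega^2}{(1+\sigma^2\omega^2)r},\qquad \sin(\theta)=\frac{(\mu+\sigma\omega^2)\omega}{(1+\sigma^2\omega^2)r}.$$ Then $$\gamma_\infty\ge\sup_{\omega>0}\left(\sqrt{\frac{\max_{x\in[0,1]}\left(\cosh(2ax)-\cos(2bx)\right)}{\cosh(2a)-\cos(2b)}}\right).$$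
   Context: For constants $\sigma>0$, $\mu\ge0$ consider the wave equation with Kelvin-Voigt and viscous damping $$\frac{\partial^2 u}{\partial t^2}(t,x)=\frac{\partial^2 u}{\partial x^2}(t,x)+\sigma\frac{\partial^3 u}{\partial t\,\partial x^2}(t,x)-\mu\frac{\partial u}{\partial t}(t,x),\quad (t,x)\in(0,+\infty)\times(0,1),$$ $$u(t,0)=d(t),\quad u(t,1)=0,\quad t\ge0,$$ with initial conditions $u[0]=f$, $\frac{\partial u}{\partial t}[0]=g$. Here $u[t]$ denotes the profile $x\mapsto u(t,x)$ (and similarly $\frac{\partial u}{\partial t}[t]$), the term $\frac{\partial^3u}{\partial t\,\partial x^2}$ is the second $x$-derivative of $\frac{\partial u}{\partial t}$, and $\mathbb{R}_+=[0,+\infty)$. $\|\cdot\|_\infty$ is the sup norm on $[0,1]$. A solution means a function $u\in C^2(\mathbb{R}_+\times[0,1])$ with $\frac{\partial u}{\partial t}[t]\in C^2([0,1])$ for all $t\ge0$ satisfying the initial-boundary value problem consisting of the differential equation $\frac{\partial^2 u}{\partial t^2}(t,x)=\frac{\partial^2 u}{\partial x^2}(t,x)+\sigma\frac{\partial^3 u}{\partial t\,\partial x^2}(t,x)-\mu\frac{\partial u}{\partial t}(t,x)$ for $(t,x)\in(0,+\infty)\times(0,1)$, the boundary conditions $u(t,0)=d(t)$, $u(t,1)=0$ for $t\ge0$, and the initial conditions $u[0]=f$, $\frac{\partial u}{\partial t}[0]=g$. $X$ is the set of all $(f,g)\in C^2([0,1])\times C^2([0,1])$ for which there exists a bounded $d\in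 C^2(\mathbb{R}_+)$ such that the initial-boundary value problem has a unique solution. For $(f,g)\in X$, $\Phi(f,g)$ is the set of bounded $d\in C^2(\mathbb{R}_+)$ for which the initial-boundary value problem with data $f,g,d$ has a unique solution. The asymptotic gain of the displacement in the sup norm is $$\gamma_\infty:=\sup\left\{\frac{\limsup_{t\to+\infty}\|u[t]\|_\infty}{\sup_{t\ge0}|d(t)|}\;:\;(f,g)\in X,\ d\in\Phi(f,g),\ d\ne0\right\},$$ where $u$ is the solution corresponding to $f,g,d$. *)

(* Defs.v *)
From Stdlib Require Import Reals.
From Coquelicot Require Import Coquelicot.

Open Scope R_scope.

(* Profiles f, g live on [0,1], boundary data d on [0,+oo) and solutions u on
   [0,+oo) x [0,1].  All are total functions on R (resp. R -> R -> R); only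
   their values on the domain are ever used. *)
Definition half_line (t : R) : Prop := 0 <= t.
Definition unit_itv (x : R) : Prop := 0 <= x <= 1.
Definition strip (p : R * R) : Prop := half_line (fst p) /\ unit_itv (snd p).

(* Derivative relative to D: one-sided at an endpoint of an interval D, and the
   same as [is_derive] at an interior point. *)
Definition is_derive_on (D : R -> Prop) (f : R -> R) (x l : R) : Prop :=
  filterdiff f (within D (locally x)) (fun y : R => scal y l).

Definition C2_on (D : R -> Prop) (f : R -> R) : Prop :=
  exists f1 f2 : R -> R,
    (forall x, D x -> is_derive_on D f x (f1 x)) /\
    (forall x, D x -> is_derive_on D f1 x (f2 x)) /\
    continuous_on D f /\ continuous_on D f1 /\ continuous_on D f2.

Definition is_dt (u ut : R -> R -> R) : Prop :=
  forall t x, strip (t, x) ->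
    is_derive_on half_line (fun s => u s x) t (ut t x).

Definition is_dx (u ux : R -> R -> R) : Prop :=
  forall t x, strip (t, x) -> is_derive_on unit_itv (u t) x (ux t x).

Definition C0_strip (u : R -> R -> R) : Prop :=
  continuous_on strip (fun p : R * R => u (fst p) (snd p)).

Definition C1_strip (u : R -> R -> R) : Prop :=
  C0_strip u /\
  exists ut ux, is_dt u ut /\ is_dx u ux /\ C0_strip ut /\ C0_strip ux.

Definition C2_strip (u : R -> R -> R) : Prop :=
  C0_strip u /\
  exists ut ux, is_dt u ut /\ is_dx u ux /\ C1_strip ut /\ C1_strip ux.

(* [v] is the time derivative of [u], one-sided at t = 0.  The differential
   equation is imposed at interior points only, where [Derive] and [Derive_n]
   are the ordinary derivatives, which exist by the regularity clauses. *)
Definition is_solution (sigma mu : R) (f g d : R -> R) (u : R -> R -> R)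
    : Prop :=
  C2_strip u /\
  exists v : R -> R -> R,
    is_dt u v /\
    (forall t, 0 <= t -> C2_on unit_itv (v t)) /\
    (forall t x, 0 < t -> 0 < x < 1 ->
       Derive (fun s => v s x) t =
         Derive_n (u t) 2 x + sigma * Derive_n (v t) 2 x - mu * v t x) /\
    (forall t, 0 <= t -> u t 0 = d t /\ u t 1 = 0) /\
    (forall x, unit_itv x -> u 0 x = f x /\ v 0 x = g x).

Definition has_unique_solution (sigma mu : R) (f g d : R -> R) : Prop :=
  (exists u, is_solution sigma mu f g d u) /\
  (forall u1 u2, is_solution sigma mu f g d u1 ->
     is_solution sigma mu f g d u2 ->
     forall t x, strip (t, x) -> u1 t x = u2 t x).

Definition bounded_on (D : R -> Prop) (d : R -> R) : Prop :=
  exists M, forall t, D t -> Rabs (d t) <= M.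

Definition Phi (sigma mu : R) (f g : R -> R) (d : R -> R) : Prop :=
  C2_on half_line d /\ bounded_on half_line d /\
  has_unique_solution sigma mu f g d.

Definition X (sigma mu : R) (f g : R -> R) : Prop :=
  C2_on unit_itv f /\ C2_on unit_itv g /\ exists d, Phi sigma mu f g d.

Definition sup_norm (D : R -> Prop) (f : R -> R) : Rbar :=
  Lub_Rbar (fun y => exists x, D x /\ y = Rabs (f x)).

(* limsup of F(t) as t -> +oo, for F defined on [0,+oo):
   inf over T >= 0 of sup over t >= T. *)
Definition limsup_pinfty (F : R -> Rbar) : Rbar :=
  Rbar_glb (fun z => exists T, 0 <= T /\
    z = Rbar_lub (fun y => exists t, T <= t /\ y = F t)).

Definition limsup_norm (u : R -> R -> R) : Rbar :=
  limsup_pinfty (fun t => sup_norm unit_itv (u t)).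

Definition gamma_infty (sigma mu : R) : Rbar :=
  Rbar_lub (fun q => exists f g d u,
    X sigma mu f g /\ Phi sigma mu f g d /\
    (exists t, 0 <= t /\ d t <> 0) /\
    is_solution sigma mu f g d u /\
    q = Rbar_div (limsup_norm u) (sup_norm half_line d)).

Definition r_of (sigma mu omega : R) : R :=
  omega * sqrt ((mu * sigma - 1) ^ 2 * omega ^ 2
                + (mu + sigma * omega ^ 2) ^ 2)
  / (1 + sigma ^ 2 * omega ^ 2).

(* [iota P] is the element satisfying P when there is exactly one. *)
Definition theta_of (sigma mu omega : R) : R :=
  iota (fun theta : R =>
    0 < theta < PI /\
    cos theta = (mu * sigma - 1) * omega ^ 2
                / ((1 + sigma ^ 2 * omega ^ 2) * r_of sigma mu omega) /\
    sin theta = (mu + sigma * omega ^ 2) * omega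
                / ((1 + sigma ^ 2 * omega ^ 2) * r_of sigma mu omega)).

Definition a_of (sigma mu omega : R) : R :=
  sqrt (r_of sigma mu omega) * cos (theta_of sigma mu omega / 2).

Definition b_of (sigma mu omega : R) : R :=
  sqrt (r_of sigma mu omega) * sin (theta_of sigma mu omega / 2).

Definition max_on (D : R -> Prop) (F : R -> R) : R :=
  iota (fun m : R => (exists x, D x /\ F x = m) /\
                     (forall x, D x -> F x <= m)).

(* Main.v *)
(** For a boundary input [cos (omega t)] the equation has the time-periodic
    solution [Re (exp (i omega t) sinh (k (1 - x)) / sinh k)] with
    [k = a + i b].  At a fixed [x] it attains the amplitude
    [|sinh (k (1 - x)) / sinh k|] at arbitrarily large times, while the input
    has sup norm 1, so every such amplitude is a lower bound of the gain.
    Uniqueness, which makes this input admissible, follows because the energy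
    [1/2 int (u_t^2 + u_x^2)] of a difference of two solutions is
    nonincreasing. *)

Require Import Defs.
From Stdlib Require Import Reals Lra.
From Coquelicot Require Import Coquelicot.

Open Scope R_scope.

(** The delicate point is regularity. In a solution the velocity is C2 in [x] for each fixed time,
    with no joint continuity of its second derivative in the definition, and derivatives at the
    edges of the strip are one-sided. The energy is therefore handled through the derivatives that
    are known to be jointly continuous, and integrands are extended to the whole plane by clamping,
    so that the ordinary theorems on parameter integrals apply. In the energy argument, time
    derivatives are taken only at [t > 0] and space derivatives only at [0 < x < 1]; continuity
    carries the conclusions to the edges. On the explicit side, [|sinh (k y)|^2 = (cosh (2 a y) -
    cos (2 b y)) / 2] with [y = 1 - x] turns the amplitudes into the stated quotient. The initial
    data are the state of the oscillation at time 0, so there is no transient to estimate. *)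

(** * Derivatives relative to a set *)

(** [filterdiff] quantifies over all limit points of the filter; [D x] puts [x] in every set of the
    filter, so [x] is the only one. *)
Lemma is_derive_on_of_is_derive (D : R -> Prop) (f : R -> R) (x l : R) :
  D x -> is_derive f x l -> is_derive_on D f x l.
Proof.
  intros Dx [Hlin H]; split; [exact Hlin|].
  intros y Hy.
  assert (Hxy : x = y).
  { apply eq_close; intros eps.
    specialize (Hy (ball y eps) (locally_ball y eps)).
    apply ball_sym; exact (locally_singleton _ _ Hy Dx). }
  subst y; intros eps.
  apply filter_le_within, H; exact (fun P HP => HP).
Qed.

Lemma is_derive_on_interior (D : R -> Prop) (f : R -> R) (x l : R) :
  locally x D -> is_derive_on D f x l -> is_derive f x l.
Proof.
  intros HD [Hlin H]; split; [exact Hlin|].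
  intros y Hy.
  rewrite <- (is_filter_lim_locally_unique _ _ Hy); intros eps.
  generalize (filter_and _ _ HD
    (H x (fun P HP => filter_le_within D P HP) eps)).
  apply filter_imp; intros z [Dz Hz]; exact (Hz Dz).
Qed.

(** The two linear approximations are compared at a point to the right of [t], which stays in the
    half line even for [t = 0]. This identifies the two time derivatives that occur in
    [is_solution]. *)
Lemma is_derive_on_half_line_unique (f : R -> R) (t l1 l2 : R) :
  0 <= t -> is_derive_on half_line f t l1 -> is_derive_on half_line f t l2 ->
  l1 = l2.
Proof.
  intros Ht [_ H1] [_ H2].
  assert (Hlim : is_filter_lim (within half_line (locally t)) t)
    by (intros P HP; exact (filter_le_within half_line P HP)).
  destruct (Req_dec l1 l2) as [E|E]; [exact E|exfalso].
  (* With a third of the gap, the two errors together reach only two thirds of it. *)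
  assert (He : 0 < Rabs (l1 - l2) / 3).
  { assert (0 < Rabs (l1 - l2)) by (apply Rabs_pos_lt; lra); lra. }
  destruct (filter_and _ _ (H1 t Hlim (mkposreal _ He))
                           (H2 t Hlim (mkposreal _ He))) as [d Hd].
  assert (Hball : ball t d (t + d / 2)).
  { change (Rabs (t + d / 2 - t) < d).
    replace (t + d / 2 - t) with (d / 2) by ring.
    generalize (cond_pos d); intros; rewrite Rabs_pos_eq; lra. }
  generalize (cond_pos d); intros Hdp.
  destruct (Hd _ Hball) as [K1 K2]; [unfold half_line; lra|].
  change (Rabs (f (t + d / 2) - f t - (t + d / 2 - t) * l1)
     <= Rabs (l1 - l2) / 3 * Rabs (t + d / 2 - t)) in K1.
  change (Rabs (f (t + d / 2) - f t - (t + d / 2 - t) * l2)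
     <= Rabs (l1 - l2) / 3 * Rabs (t + d / 2 - t)) in K2.
  replace (t + d / 2 - t) with (d / 2) in K1, K2 by ring.
  rewrite (Rabs_pos_eq (d / 2)) in K1, K2 by lra.
  assert (K3 : Rabs (l1 - l2) * (d / 2) <= 2 * (Rabs (l1 - l2) / 3 * (d / 2))).
  { rewrite <- (Rabs_pos_eq (d / 2)) at 1 by lra.
    rewrite <- Rabs_mult.
    replace ((l1 - l2) * (d / 2)) with
      ((f (t + d / 2) - f t - d / 2 * l2) - (f (t + d / 2) - f t - d / 2 * l1))
      by ring.
    eapply Rle_trans; [apply Rabs_triang|].
    rewrite Rabs_Ropp; lra. }
  nra.
Qed.

Lemma locally_half_line (t : R) : 0 < t -> locally t half_line.
Proof.
  intros Ht; exists (mkposreal t Ht); intros y Hy.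
  apply Rabs_def2 in Hy; simpl in Hy; unfold half_line.
  change (y - t < t /\ - t < y - t) in Hy; lra.
Qed.

Lemma locally_open_unit (x : R) :
  0 < x < 1 -> locally x (fun y => 0 < y < 1).
Proof.
  intros Hx.
  assert (Hd : 0 < Rmin x (1 - x)) by (apply Rmin_glb_lt; lra).
  exists (mkposreal _ Hd); intros y Hy.
  apply Rabs_def2 in Hy; simpl in Hy.
  change (y - x < Rmin x (1 - x) /\ - Rmin x (1 - x) < y - x) in Hy.
  generalize (Rmin_l x (1 - x)) (Rmin_r x (1 - x)); lra.
Qed.

Lemma locally_unit_itv (x : R) : 0 < x < 1 -> locally x unit_itv.
Proof.
  intros Hx; generalize (locally_open_unit x Hx).
  apply filter_imp; unfold unit_itv; intros; lra.
Qed.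

(** * Clamping to the strip *)

Definition clamp0 (t : R) : R := Rmax 0 t.
Definition clamp01 (x : R) : R := Rmax 0 (Rmin 1 x).

Lemma clamp0_half_line (t : R) : half_line (clamp0 t).
Proof. apply Rmax_l. Qed.

Lemma clamp01_unit_itv (x : R) : unit_itv (clamp01 x).
Proof.
  unfold unit_itv, clamp01, Rmax, Rmin.
  destruct (Rle_dec 1 x), (Rle_dec 0 _); lra.
Qed.

Lemma clamp0_id (t : R) : 0 <= t -> clamp0 t = t.
Proof. intros; apply Rmax_right; lra. Qed.

Lemma clamp01_id (x : R) : unit_itv x -> clamp01 x = x.
Proof. intros []; unfold clamp01; rewrite Rmin_right, Rmax_right; lra. Qed.

Lemma clamp0_lipschitz (s t : R) : Rabs (clamp0 s - clamp0 t) <= Rabs (s - t).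
Proof.
  unfold clamp0, Rmax, Rabs.
  repeat first [destruct (Rle_dec _ _) | destruct (Rcase_abs _)]; lra.
Qed.

Lemma clamp01_lipschitz (x y : R) :
  Rabs (clamp01 x - clamp01 y) <= Rabs (x - y).
Proof.
  unfold clamp01, Rmax, Rmin, Rabs.
  repeat first [destruct (Rle_dec _ _) | destruct (Rcase_abs _)]; lra.
Qed.

(** Composition with the nearest-point retraction onto the strip. The retraction is 1-Lipschitz in
    each variable, so relative continuity on the strip becomes continuity at every point of the
    plane. *)
Definition clamped (h : R -> R -> R) (t x : R) : R := h (clamp0 t) (clamp01 x).

Lemma clamped_id (h : R -> R -> R) (t x : R) :
  0 <= t -> unit_itv x -> clamped h t x = h t x.
Proof.
  intros Ht Hx; unfold clamped; now rewrite clamp0_id, clamp01_id.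
Qed.

Lemma clamped_continuity_2d (h : R -> R -> R) (t x : R) :
  C0_strip h -> continuity_2d_pt (clamped h) t x.
Proof.
  intros H eps.
  destruct (H (clamp0 t, clamp01 x)
    (conj (clamp0_half_line t) (clamp01_unit_itv x))
    (ball (h (clamp0 t) (clamp01 x)) eps) (locally_ball _ eps)) as [d Hd].
  exists d; intros s y Hs Hy.
  apply (Hd (clamp0 s, clamp01 y)).
  - split.
    + exact (Rle_lt_trans _ _ _ (clamp0_lipschitz s t) Hs).
    + exact (Rle_lt_trans _ _ _ (clamp01_lipschitz y x) Hy).
  - split; [apply clamp0_half_line | apply clamp01_unit_itv].
Qed.

Lemma clamped_continuous_x (h : R -> R -> R) (t x : R) :
  C0_strip h -> continuous (clamped h t) x.
Proof.
  intros H; apply continuity_pt_filterlim, continuity_pt_locally; intros eps.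
  destruct (clamped_continuity_2d h t x H eps) as [d Hd].
  exists d; intros y Hy; apply Hd; [|exact Hy].
  rewrite Rminus_diag, Rabs_R0; apply cond_pos.
Qed.

Lemma clamped_continuous_t (h : R -> R -> R) (t x : R) :
  C0_strip h -> continuity_pt (fun s => clamped h s x) t.
Proof.
  intros H; apply continuity_pt_locally; intros eps.
  destruct (clamped_continuity_2d h t x H eps) as [d Hd].
  exists d; intros y Hy; apply Hd; [exact Hy|].
  rewrite Rminus_diag, Rabs_R0; apply cond_pos.
Qed.

Lemma C0_strip_comp2 (op : R -> R -> R) (h k : R -> R -> R) :
  (forall a b, filterlim (fun z => op (fst z) (snd z))
     (filter_prod (locally a) (locally b)) (locally (op a b))) ->
  C0_strip h -> C0_strip k -> C0_strip (fun t x => op (h t x) (k t x)).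
Proof.
  intros Hop Hh Hk p Dp.
  exact (filterlim_comp_2
    (fun p : R * R => h (fst p) (snd p)) (fun p : R * R => k (fst p) (snd p))
    op (Hh p Dp) (Hk p Dp) (Hop _ _)).
Qed.

Lemma C0_strip_plus (h k : R -> R -> R) :
  C0_strip h -> C0_strip k -> C0_strip (fun t x => h t x + k t x).
Proof.
  apply (C0_strip_comp2 Rplus); intros a b.
  exact (filterlim_plus (V := R_NormedModule) a b).
Qed.

Lemma C0_strip_mult (h k : R -> R -> R) :
  C0_strip h -> C0_strip k -> C0_strip (fun t x => h t x * k t x).
Proof.
  apply (C0_strip_comp2 Rmult); intros a b.
  exact (filterlim_mult (K := R_AbsRing) a b).
Qed.

Lemma C0_strip_const (c : R) : C0_strip (fun _ _ => c).
Proof. intros p _; apply filterlim_const. Qed.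

Lemma C0_strip_ext (h k : R -> R -> R) :
  (forall t x, strip (t, x) -> h t x = k t x) -> C0_strip h -> C0_strip k.
Proof.
  intros E; apply continuous_on_ext; intros [t x] D; exact (E t x D).
Qed.

Lemma C0_strip_minus (h k : R -> R -> R) :
  C0_strip h -> C0_strip k -> C0_strip (fun t x => h t x - k t x).
Proof.
  intros Hh Hk.
  apply (C0_strip_ext (fun t x => h t x + -1 * k t x));
    [intros; ring|].
  apply C0_strip_plus, C0_strip_mult; try assumption; apply C0_strip_const.
Qed.

(** * Integrals over the unit interval *)

Lemma ex_RInt_clamped (h : R -> R -> R) (t a b : R) :
  C0_strip h -> ex_RInt (clamped h t) a b.
Proof.
  intros H; apply (ex_RInt_continuous (V := R_CompleteNormedModule)).
  intros x _; now apply clamped_continuous_x.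
Qed.

(** By compactness of [0,1] the integrands at nearby times are uniformly close, and the interval has
    length 1. *)
Lemma RInt_clamped_continuous (h : R -> R -> R) (t : R) :
  C0_strip h -> continuity_pt (fun s => RInt (clamped h s) 0 1) t.
Proof.
  intros H; apply continuity_pt_locally; intros eps.
  destruct (uniform_continuity_2d_1d' (clamped h) 0 1 t
    (fun x _ => clamped_continuity_2d h t x H) (pos_div_2 eps)) as [d Hd].
  exists d; intros s Hs.
  change (Rabs (s - t) < d) in Hs; apply Rabs_def2 in Hs.
  generalize (cond_pos d) (cond_pos eps); intros Hdp Hep.
  replace (RInt (clamped h s) 0 1 - RInt (clamped h t) 0 1) with
    (RInt (fun x => clamped h s x - clamped h t x) 0 1)
    by (apply (RInt_minus (V := R_CompleteNormedModule) (clamped h s)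
      (clamped h t) 0 1); now apply ex_RInt_clamped).
  apply Rle_lt_trans with ((1 - 0) * (eps / 2)); [|lra].
  apply (norm_RInt_le_const (V := R_NormedModule)
    (fun x => clamped h s x - clamped h t x) 0 1); [lra| |].
  - intros x Hx; left.
    apply (Hd x t x s); try lra.
    rewrite Rminus_diag, Rabs_R0; lra.
  - apply (RInt_correct (V := R_CompleteNormedModule)).
    apply (ex_RInt_minus (V := R_NormedModule)); now apply ex_RInt_clamped.
Qed.

(** Leibniz's rule. It is stated for [t > 0] because a clamped function is constant in time for
    negative times and may have a kink at 0. *)
Lemma is_derive_RInt_clamped (h ht : R -> R -> R) (t : R) :
  C0_strip h -> C0_strip ht ->
  (forall s x, 0 < s -> unit_itv x ->
     is_derive (fun z => h z x) s (ht s x)) ->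
  0 < t ->
  is_derive (fun s => RInt (clamped h s) 0 1) t (RInt (clamped ht t) 0 1).
Proof.
  intros Ch Cht Hd Ht.
  assert (Hc : forall s x, 0 < s ->
    is_derive (fun z => clamped h z x) s (clamped ht s x)).
  { intros s x Hs; unfold clamped at 2; rewrite clamp0_id by lra.
    apply (is_derive_ext_loc (fun z => h z (clamp01 x))).
    - generalize (locally_half_line s Hs); apply filter_imp; intros z Hz.
      unfold clamped; now rewrite clamp0_id.
    - apply Hd; [exact Hs|apply clamp01_unit_itv]. }
  assert (Hpos : locally t (fun s => 0 < s)) by exact (open_gt 0 t Ht).
  rewrite (RInt_ext (V := R_CompleteNormedModule) (clamped ht t)
    (fun x => Derive (fun z => clamped h z x) t)).
  2:{ intros x _; symmetry; apply is_derive_unique; now apply Hc. }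
  apply is_derive_RInt_param.
  - revert Hpos; apply filter_imp; intros s Hs x _.
    exists (clamped ht s x); now apply Hc.
  - intros x _.
    apply (continuity_2d_pt_ext_loc (clamped ht)).
    + destruct Hpos as [d Hp]; exists d; intros s y Hs _.
      symmetry; apply is_derive_unique, Hc, Hp, Hs.
    + now apply clamped_continuity_2d.
  - apply filter_forall; intros s; now apply ex_RInt_clamped.
Qed.

(** A primitive of [f] minus [F] has zero derivative inside and is continuous up to the endpoints,
    so the mean value theorem makes it constant. Thus [F] need not be differentiable at 0 and 1,
    where a clamped function may have kinks. *)
Lemma RInt_interior_derive (F f : R -> R) :
  (forall x, continuous F x) -> (forall x, continuous f x) ->
  (forall x, 0 < x < 1 -> is_derive F x (f x)) ->
  RInt f 0 1 = F 1 - F 0.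
Proof.
  intros CF Cf HF.
  assert (Hint : forall x, is_derive (RInt f 0) x (f x)).
  { intros x; apply (is_derive_RInt f (RInt f 0) 0); [|apply Cf].
    apply filter_forall; intros y.
    apply (RInt_correct (V := R_CompleteNormedModule)).
    apply (ex_RInt_continuous (V := R_CompleteNormedModule)); intros; apply Cf. }
  destruct (MVT_gen (fun x => RInt f 0 x - F x) 0 1 (fun _ => 0)) as [c [_ Hc]].
  - rewrite Rmin_left, Rmax_right by lra; intros x Hx.
    generalize (is_derive_minus (V := R_NormedModule) _ _ _ _ _
      (Hint x) (HF x Hx)).
    rewrite minus_eq_zero; exact (fun H => H).
  - intros x _; apply continuity_pt_minus; apply continuity_pt_filterlim.
    + apply (ex_derive_continuous (V := R_NormedModule)).
      exists (f x); apply Hint.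
    + apply CF.
  - rewrite (RInt_point 0 f) in Hc.
    change (zero : R) with 0 in Hc; lra.
Qed.

(** The integral from 0 to [y] lies between 0 and the full integral, so it vanishes for all [y]; its
    derivative is [f]. *)
Lemma RInt_nonpos_eq_0 (f : R -> R) (x : R) :
  (forall y, continuous f y) -> (forall y, 0 <= f y) -> RInt f 0 1 <= 0 ->
  0 < x < 1 -> f x = 0.
Proof.
  intros Cf Pf Hle Hx.
  assert (Hex : forall a b, ex_RInt f a b).
  { intros; apply (ex_RInt_continuous (V := R_CompleteNormedModule));
    intros; apply Cf. }
  assert (Hz : forall y, 0 < y < 1 -> RInt f 0 y = 0).
  { intros y Hy.
    generalize (RInt_Chasles (V := R_CompleteNormedModule) f 0 y 1
      (Hex _ _) (Hex _ _)).
    change (@plus R_CompleteNormedModule) with Rplus.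
    assert (0 <= RInt f 0 y) by (apply RInt_ge_0; auto; lra).
    assert (0 <= RInt f y 1) by (apply RInt_ge_0; auto; lra).
    lra. }
  rewrite <- (is_derive_unique (RInt f 0) x (f x)).
  - rewrite (Derive_ext_loc _ (fun _ => 0)); [apply Derive_const|].
    generalize (locally_open_unit x Hx); apply filter_imp; exact Hz.
  - apply (is_derive_RInt f (RInt f 0) 0); [|apply Cf].
    apply filter_forall; intros y.
    apply (RInt_correct (V := R_CompleteNormedModule)), Hex.
Qed.

Lemma is_derive_nonpos_le (F : R -> R) (t : R) :
  0 <= t -> (forall s, continuity_pt F s) ->
  (forall s, 0 < s -> exists l, l <= 0 /\ is_derive F s l) ->
  F t <= F 0.
Proof.
  intros Ht CF HF.
  (* The mean value point may be the endpoint 0, where nothing is known about the derivative; the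
     truncation [Rmin 0] gives the right sign there as well. *)
  destruct (MVT_gen F 0 t (fun s => Rmin 0 (Derive F s))) as [c [_ Hc]].
  - rewrite Rmin_left by lra; intros s Hs.
    destruct (HF s) as [l [Hl Hd]]; [lra|].
    rewrite (is_derive_unique F s l Hd), Rmin_right by lra; exact Hd.
  - intros; apply CF.
  - generalize (Rmin_l 0 (Derive F c)); nra.
Qed.

(** * Uniqueness by the energy method *)

(* The equation is solved for the second x-derivative of [v]; since the other
   terms are continuous on the closed strip, this is where the continuity of
   that derivative up to the boundary comes from. *)
Record regular_solution (sigma mu : R)
    (u v ux vt vx uxt uxx : R -> R -> R) : Prop := {
  rs_ut : forall t x, 0 < t -> unit_itv x ->
    is_derive (fun s => u s x) t (v t x);
  rs_ux : forall t x, 0 <= t -> 0 < x < 1 -> is_derive (u t) x (ux t x);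
  rs_vt : forall t x, 0 < t -> unit_itv x ->
    is_derive (fun s => v s x) t (vt t x);
  rs_vx : forall t x, 0 < t -> 0 < x < 1 -> is_derive (v t) x (vx t x);
  rs_uxt : forall t x, 0 < t -> unit_itv x ->
    is_derive (fun s => ux s x) t (uxt t x);
  rs_uxx : forall t x, 0 < t -> 0 < x < 1 -> is_derive (ux t) x (uxx t x);
  rs_vxx : forall t x, 0 < t -> 0 < x < 1 ->
    is_derive (vx t) x ((vt t x - uxx t x + mu * v t x) / sigma);
  rs_Cu : C0_strip u; rs_Cv : C0_strip v; rs_Cux : C0_strip ux;
  rs_Cvt : C0_strip vt; rs_Cvx : C0_strip vx; rs_Cuxt : C0_strip uxt;
  rs_Cuxx : C0_strip uxx }.

Lemma regular_solution_minus (sigma mu : R)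
    (u v ux vt vx uxt uxx u' v' ux' vt' vx' uxt' uxx' : R -> R -> R) :
  regular_solution sigma mu u v ux vt vx uxt uxx ->
  regular_solution sigma mu u' v' ux' vt' vx' uxt' uxx' ->
  regular_solution sigma mu
    (fun t x => u t x - u' t x) (fun t x => v t x - v' t x)
    (fun t x => ux t x - ux' t x) (fun t x => vt t x - vt' t x)
    (fun t x => vx t x - vx' t x) (fun t x => uxt t x - uxt' t x)
    (fun t x => uxx t x - uxx' t x).
Proof.
  intros [] []; constructor; try (now apply C0_strip_minus);
    intros t x Ht Hx.
  all: try (match goal with |- context [_ / _] =>
    replace (_ / _) with
      ((vt t x - uxx t x + mu * v t x) / sigma
       - (vt' t x - uxx' t x + mu * v' t x) / sigma)
      by (unfold Rdiv; ring) end).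
  all: apply (is_derive_minus (V := R_NormedModule)); auto.
Qed.

(** Passes from constant boundary values of [u] to zero boundary values of its velocity. *)
Lemma is_derive_const_on_half_line (f : R -> R) (t l : R) :
  0 < t -> (forall s, 0 <= s -> f s = f t) -> is_derive f t l -> l = 0.
Proof.
  intros Ht Hf Hd; rewrite <- (is_derive_unique f t l Hd).
  rewrite (Derive_ext_loc _ (fun _ => f t)); [apply Derive_const|].
  generalize (locally_half_line t Ht); apply filter_imp; exact Hf.
Qed.

(** Differentiating the energy in time produces [uxt], integrating by parts in space produces [vx].
    Both are continuous on the strip, so Schwarz's theorem equates them at interior points. *)
Lemma mixed_derivatives_eq (sigma mu : R)
    (u v ux vt vx uxt uxx : R -> R -> R) (t x : R) :
  regular_solution sigma mu u v ux vt vx uxt uxx -> 0 < t -> 0 < x < 1 ->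
  uxt t x = vx t x.
Proof.
  intros Hu Ht Hx.
  assert (Loc : locally_2d (fun s y => 0 < s /\ 0 < y < 1) t x).
  { destruct (locally_open_unit x Hx) as [d1 H1].
    assert (Hd : 0 < Rmin d1 t)
      by (apply Rmin_glb_lt; [apply cond_pos|exact Ht]).
    exists (mkposreal _ Hd); simpl; intros s y Hs Hy.
    generalize (Rmin_l d1 t) (Rmin_r d1 t); intros.
    split; [apply Rabs_def2 in Hs; lra|].
    apply H1; unfold ball; simpl; unfold AbsRing_ball; simpl.
    apply Rlt_le_trans with (1 := Hy); lra. }
  assert (Dt : forall s y, 0 < s -> unit_itv y ->
      Derive (fun z => u z y) s = v s y)
    by (intros; now apply is_derive_unique, (rs_ut _ _ _ _ _ _ _ _ _ Hu)).
  assert (Dx : forall s y, 0 < s -> 0 < y < 1 -> Derive (u s) y = ux s y).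
  { intros; apply is_derive_unique, (rs_ux _ _ _ _ _ _ _ _ _ Hu); lra. }
  assert (Dxt : forall s y, 0 < s -> 0 < y < 1 ->
      is_derive (fun z => Derive (u z) y) s (uxt s y)).
  { intros s y Hs Hy; apply (is_derive_ext_loc (fun z => ux z y)).
    - generalize (open_gt 0 s Hs); apply filter_imp; intros z Hz.
      symmetry; now apply Dx.
    - apply (rs_uxt _ _ _ _ _ _ _ _ _ Hu); unfold unit_itv; lra. }
  assert (Dtx : forall s y, 0 < s -> 0 < y < 1 ->
      is_derive (fun z => Derive (fun r => u r z) s) y (vx s y)).
  { intros s y Hs Hy; apply (is_derive_ext_loc (v s)).
    - generalize (locally_unit_itv y Hy); apply filter_imp; intros z Hz.
      symmetry; now apply Dt.
    - now apply (rs_vx _ _ _ _ _ _ _ _ _ Hu). }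
  (* Schwarz's theorem asks for continuity of the iterated [Derive]; near the point these agree with
     the clamped [uxt] and [vx]. *)
  assert (Cont : forall h k, C0_strip h ->
      (forall s y, 0 < s -> 0 < y < 1 -> h s y = k s y) ->
      continuity_2d_pt k t x).
  { intros h k Ch E; apply (continuity_2d_pt_ext_loc (clamped h)).
    - revert Loc; apply locally_2d_impl, locally_2d_forall.
      intros s y [Hs Hy]; rewrite clamped_id by (unfold unit_itv; lra).
      now apply E.
    - now apply clamped_continuity_2d. }
  rewrite <- (is_derive_unique _ _ _ (Dxt t x Ht Hx)).
  rewrite <- (is_derive_unique _ _ _ (Dtx t x Ht Hx)).
  apply Schwarz.
  - revert Loc; apply locally_2d_impl, locally_2d_forall.
    intros s y [Hs Hy]; split; [|split; [|split]].
    + exists (v s y); apply (rs_ut _ _ _ _ _ _ _ _ _ Hu);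
        unfold unit_itv; lra.
    + exists (ux s y); apply (rs_ux _ _ _ _ _ _ _ _ _ Hu); lra.
    + exists (uxt s y); now apply Dxt.
    + exists (vx s y); now apply Dtx.
  - apply (Cont uxt); [apply (rs_Cuxt _ _ _ _ _ _ _ _ _ Hu)|].
    intros; symmetry; now apply is_derive_unique, Dxt.
  - apply (Cont vx); [apply (rs_Cvx _ _ _ _ _ _ _ _ _ Hu)|].
    intros; symmetry; now apply is_derive_unique, Dtx.
Qed.

(* With [vxx] read off the equation, [(v (ux + sigma vx))_x] equals
   [v vt + ux vx + sigma vx^2 + mu v^2], and its integral vanishes by the
   boundary conditions. *)
Lemma energy_derivative_nonpos (sigma mu : R)
    (u v ux vt vx uxt uxx : R -> R -> R) (t : R) :
  0 < sigma -> 0 <= mu ->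
  regular_solution sigma mu u v ux vt vx uxt uxx ->
  0 < t -> v t 0 = 0 -> v t 1 = 0 ->
  RInt (clamped (fun t x => v t x * vt t x + ux t x * uxt t x) t) 0 1 <= 0.
Proof.
  intros Hs Hm Hu Ht Hv0 Hv1.
  pose (G := fun t x => v t x * (ux t x + sigma * vx t x)).
  pose (g := fun t x => v t x * vt t x + ux t x * vx t x
    + sigma * (vx t x * vx t x) + mu * (v t x * v t x)).
  pose proof Hu as [].
  assert (CG : C0_strip G)
    by (apply C0_strip_mult, C0_strip_plus, C0_strip_mult; try assumption;
        apply C0_strip_const).
  assert (Cg : C0_strip g)
    by (repeat (apply C0_strip_plus || apply C0_strip_mult); try assumption;
        apply C0_strip_const).
  assert (Ce : C0_strip (fun t x => v t x * vt t x + ux t x * uxt t x))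
    by (apply C0_strip_plus; apply C0_strip_mult; assumption).
  replace 0 with (clamped G t 1 - clamped G t 0) at 2.
  2:{ rewrite !clamped_id by (unfold unit_itv; lra).
      unfold G; rewrite Hv0, Hv1; ring. }
  rewrite <- (RInt_interior_derive (clamped G t) (clamped g t)).
  - apply RInt_le; [lra|now apply ex_RInt_clamped..|].
    intros x Hx; rewrite !clamped_id by (unfold unit_itv; lra).
    unfold g.
    rewrite (mixed_derivatives_eq _ _ _ _ _ _ _ _ _ _ _ Hu Ht Hx).
    generalize (Rle_0_sqr (vx t x)) (Rle_0_sqr (v t x)); unfold Rsqr; nra.
  - intros; now apply clamped_continuous_x.
  - intros; now apply clamped_continuous_x.
  - intros x Hx; rewrite clamped_id by (unfold unit_itv; lra).
    apply (is_derive_ext_loc (G t)).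
    + generalize (locally_unit_itv x Hx); apply filter_imp; intros y Hy.
      symmetry; apply clamped_id; [lra|exact Hy].
    + unfold G, g.
      evar_last.
      * apply (is_derive_mult (v t) (fun x => ux t x + sigma * vx t x)).
        -- now apply rs_vx0.
        -- apply (is_derive_plus (V := R_NormedModule)); [now apply rs_uxx0|].
           apply (is_derive_scal (vx t) x sigma); now apply rs_vxx0.
        -- intros; apply Rmult_comm.
      * unfold plus, mult; simpl; unfold plus, mult; simpl; field; lra.
Qed.

(** The energy [E] starts at 0 and does not increase, while its density [e] is nonnegative; hence
    [e] and with it [v] vanish inside. Then [u] is constant in time and keeps its initial value
    0. *)
Lemma homogeneous_solution_zero (sigma mu : R)
    (u v ux vt vx uxt uxx : R -> R -> R) :
  0 < sigma -> 0 <= mu ->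
  regular_solution sigma mu u v ux vt vx uxt uxx ->
  (forall t, 0 <= t -> u t 0 = 0 /\ u t 1 = 0) ->
  (forall x, unit_itv x -> u 0 x = 0 /\ v 0 x = 0) ->
  forall t x, strip (t, x) -> u t x = 0.
Proof.
  intros Hs Hm Hu HB HI.
  pose proof Hu as [].
  pose (e := fun t x => / 2 * (v t x * v t x + ux t x * ux t x)).
  pose (et := fun t x => v t x * vt t x + ux t x * uxt t x).
  pose (E := fun t => RInt (clamped e t) 0 1 : R).
  assert (Ce : C0_strip e)
    by (repeat (apply C0_strip_plus || apply C0_strip_mult); try assumption;
        apply C0_strip_const).
  assert (Cet : C0_strip et)
    by (apply C0_strip_plus; apply C0_strip_mult; assumption).
  assert (He0 : E 0 = 0).
  { unfold E; rewrite (RInt_ext _ (fun _ => 0)).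
    - rewrite RInt_const; unfold scal; simpl; unfold mult; simpl; ring.
    - rewrite Rmin_left, Rmax_right by lra; intros x Hx.
      rewrite clamped_id by (unfold unit_itv; lra).
      unfold e; rewrite (proj2 (HI x ltac:(unfold unit_itv; lra))).
      (* The initial slope vanishes because [u 0] is zero on the whole interval. *)
      replace (ux 0 x) with 0.
      { change (/ 2 * (0 * 0 + 0 * 0) = 0 :> R); ring. }
      rewrite <- (is_derive_unique _ _ _ (rs_ux0 0 x (Rle_refl 0) Hx)).
      rewrite (Derive_ext_loc _ (fun _ => 0)); [now rewrite Derive_const|].
      generalize (locally_unit_itv x Hx); apply filter_imp.
      intros y Hy; now apply HI. }
  assert (HE : forall t, 0 <= t -> E t <= 0).
  { intros t Ht; rewrite <- He0; apply is_derive_nonpos_le; [exact Ht| |].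
    - intros s; now apply RInt_clamped_continuous.
    - intros s Hs0; exists (RInt (clamped et s) 0 1); split.
      + apply (energy_derivative_nonpos sigma mu u v ux vt vx uxt uxx);
          try assumption.
        * apply (is_derive_const_on_half_line (fun s => u s 0) s);
            [exact Hs0| |apply rs_ut0; unfold unit_itv; lra].
          intros z Hz; rewrite (proj1 (HB z Hz)), (proj1 (HB s ltac:(lra)));
            reflexivity.
        * apply (is_derive_const_on_half_line (fun s => u s 1) s);
            [exact Hs0| |apply rs_ut0; unfold unit_itv; lra].
          intros z Hz; rewrite (proj2 (HB z Hz)), (proj2 (HB s ltac:(lra)));
            reflexivity.
      + apply is_derive_RInt_clamped; try assumption.
        intros z y Hz Hy; unfold e, et.
        evar_last.
        * apply (is_derive_scal (fun z => v z y * v z y + ux z y * ux z y)).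
          apply (is_derive_plus (V := R_NormedModule)).
          -- apply (is_derive_mult (fun z => v z y) (fun z => v z y));
               [now apply rs_vt0..|intros; apply Rmult_comm].
          -- apply (is_derive_mult (fun z => ux z y) (fun z => ux z y));
               [now apply rs_uxt0..|intros; apply Rmult_comm].
        * unfold plus, mult; simpl; unfold plus, mult; simpl; field. }
  assert (Hv : forall t x, 0 <= t -> 0 < x < 1 -> v t x = 0).
  { intros t x Ht Hx.
    assert (Z : clamped e t x = 0).
    { apply RInt_nonpos_eq_0; [| |now apply HE|exact Hx].
      - intros; now apply clamped_continuous_x.
      - intros y; unfold clamped, e.
        generalize (Rle_0_sqr (v (clamp0 t) (clamp01 y)))
          (Rle_0_sqr (ux (clamp0 t) (clamp01 y))); unfold Rsqr; lra. }
    rewrite clamped_id in Z by (unfold unit_itv; lra).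
    unfold e in Z.
    generalize (Rle_0_sqr (v t x)) (Rle_0_sqr (ux t x)); unfold Rsqr; intros.
    apply Rsqr_0_uniq; unfold Rsqr; lra. }
  intros t x [Ht Hx]; simpl in Ht, Hx; unfold half_line in Ht.
  destruct (Req_dec x 0) as [->|N0]; [now apply HB|].
  destruct (Req_dec x 1) as [->|N1]; [now apply HB|].
  assert (Hx' : 0 < x < 1) by (destruct Hx; lra).
  rewrite <- (proj1 (HI x Hx)).
  destruct (MVT_gen (fun s => clamped u s x) 0 t (fun _ => 0)) as [c [_ Hc]].
  - rewrite Rmin_left by lra; intros s Hs0.
    rewrite <- (Hv s x) by lra.
    apply (is_derive_ext_loc (fun s => u s x)).
    + generalize (locally_half_line s ltac:(lra)); apply filter_imp.
      intros z Hz; symmetry; now apply clamped_id.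
    + apply rs_ut0; [lra|exact Hx].
  - intros; now apply clamped_continuous_t.
  - rewrite !clamped_id in Hc by (assumption || lra); lra.
Qed.

(** [C2_strip] and the equation each bring their own time derivative, [v] and [v']. They agree on
    the strip, so the second derivative that [C2_on] gives for [v' t] is a derivative of [vx t], and
    the equation fixes its value. *)
Lemma is_solution_regular (sigma mu : R) (f g d : R -> R) (u : R -> R -> R) :
  0 < sigma -> is_solution sigma mu f g d u ->
  exists v ux vt vx uxt uxx, regular_solution sigma mu u v ux vt vx uxt uxx /\
    (forall t, 0 <= t -> u t 0 = d t /\ u t 1 = 0) /\
    (forall x, unit_itv x -> u 0 x = f x /\ v 0 x = g x).
Proof.
  intros Hs [[Cu [v [ux [Hut [Hux [[Cv [vt [vx [Hvt [Hvx [Cvt Cvx]]]]]]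
    [Cux [uxt [uxx [Huxt [Huxx [Cuxt Cuxx]]]]]]]]]]]]
    [v' [Hut' [HC2 [Hpde [HB HI]]]]]].
  assert (Ev : forall t x, 0 <= t -> unit_itv x -> v' t x = v t x).
  { intros t x Ht Hx.
    exact (is_derive_on_half_line_unique _ _ _ _ Ht
      (Hut' t x (conj Ht Hx)) (Hut t x (conj Ht Hx))). }
  assert (It : forall h ht, is_dt h ht -> forall t x, 0 < t -> unit_itv x ->
      is_derive (fun s => h s x) t (ht t x)).
  { intros h ht Hh t x Ht Hx; apply (is_derive_on_interior half_line).
    - now apply locally_half_line.
    - apply Hh; split; [unfold half_line; simpl; lra|exact Hx]. }
  assert (Ix : forall h hx, is_dx h hx -> forall t x, 0 <= t -> 0 < x < 1 ->
      is_derive (h t) x (hx t x)).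
  { intros h hx Hh t x Ht Hx; apply (is_derive_on_interior unit_itv).
    - now apply locally_unit_itv.
    - apply Hh; split; unfold unit_itv; simpl; [exact Ht|lra]. }
  exists v, ux, vt, vx, uxt, uxx; split; [|split; [exact HB|]].
  2:{ intros x Hx; rewrite <- Ev; [now apply HI|lra|exact Hx]. }
  constructor; try assumption; try (now apply It).
  - now apply Ix.
  - intros; apply Ix; [assumption|lra|assumption].
  - intros; apply Ix; [assumption|lra|assumption].
  - intros t x Ht Hx.
    destruct (HC2 t) as [v1 [v2 [H1 [H2 _]]]]; [lra|].
    assert (D1 : forall y, 0 < y < 1 -> is_derive (v' t) y (v1 y)).
    { intros y Hy; apply (is_derive_on_interior unit_itv).
      - now apply locally_unit_itv.
      - apply H1; unfold unit_itv; lra. }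
    assert (D2 : is_derive v1 x (v2 x)).
    { apply (is_derive_on_interior unit_itv).
      - now apply locally_unit_itv.
      - apply H2; unfold unit_itv; lra. }
    assert (E1 : forall y, 0 < y < 1 -> v1 y = vx t y).
    { intros y Hy; rewrite <- (is_derive_unique _ _ _ (D1 y Hy)).
      rewrite <- (is_derive_unique _ _ _ (Ix v vx Hvx t y ltac:(lra) Hy)).
      apply Derive_ext_loc.
      generalize (locally_unit_itv y Hy); apply filter_imp.
      intros z Hz; apply Ev; [lra|exact Hz]. }
    assert (Ex : unit_itv x) by (unfold unit_itv; lra).
    assert (Evt : Derive (fun s => v' s x) t = vt t x).
    { rewrite <- (is_derive_unique _ _ _ (It v vt Hvt t x Ht Ex)).
      apply Derive_ext_loc.
      generalize (locally_half_line t Ht); apply filter_imp.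
      intros s Hs'; now apply Ev. }
    assert (Euxx : Derive_n (u t) 2 x = uxx t x).
    { rewrite <- (is_derive_unique _ _ _ (Ix ux uxx Huxx t x ltac:(lra) Hx)).
      apply Derive_ext_loc.
      generalize (locally_open_unit x Hx); apply filter_imp.
      intros y Hy; apply is_derive_unique, (Ix u ux Hux); [lra|exact Hy]. }
    assert (Evxx : Derive_n (v' t) 2 x = v2 x).
    { rewrite <- (is_derive_unique _ _ _ D2).
      apply Derive_ext_loc.
      generalize (locally_open_unit x Hx); apply filter_imp.
      intros y Hy; now apply is_derive_unique, D1. }
    generalize (Hpde t x Ht Hx); rewrite Evt, Euxx, Evxx, Ev by (lra || exact Ex).
    intros P.
    (* The equation solved for the second space derivative of the velocity; [sigma > 0] permits the
       division. *)
    replace ((vt t x - uxx t x + mu * v t x) / sigma) with (v2 x)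
      by (rewrite P; field; lra).
    apply (is_derive_ext_loc v1); [|exact D2].
    generalize (locally_open_unit x Hx); apply filter_imp; exact E1.
Qed.

Lemma is_solution_unique (sigma mu : R) (f g d : R -> R)
    (u1 u2 : R -> R -> R) :
  0 < sigma -> 0 <= mu ->
  is_solution sigma mu f g d u1 -> is_solution sigma mu f g d u2 ->
  forall t x, strip (t, x) -> u1 t x = u2 t x.
Proof.
  intros Hs Hm S1 S2 t x Htx.
  destruct (is_solution_regular _ _ _ _ _ _ Hs S1)
    as [v1 [ux1 [vt1 [vx1 [uxt1 [uxx1 [R1 [B1 I1]]]]]]]].
  destruct (is_solution_regular _ _ _ _ _ _ Hs S2)
    as [v2 [ux2 [vt2 [vx2 [uxt2 [uxx2 [R2 [B2 I2]]]]]]]].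
  apply Rminus_diag_uniq.
  apply (homogeneous_solution_zero _ _ _ _ _ _ _ _ _ Hs Hm
    (regular_solution_minus _ _ _ _ _ _ _ _ _ _ _ _ _ _ _ _ R1 R2));
    [| |exact Htx].
  - intros s Ht; destruct (B1 s Ht), (B2 s Ht); split; lra.
  - intros y Hy; destruct (I1 y Hy), (I2 y Hy); split; lra.
Qed.

(** * Time-periodic solutions *)

Lemma C2_on_of_is_derive (D : R -> Prop) (f f1 f2 : R -> R) :
  (forall x, is_derive f x (f1 x)) -> (forall x, is_derive f1 x (f2 x)) ->
  (forall x, continuous f2 x) -> C2_on D f.
Proof.
  intros H1 H2 C2; exists f1, f2.
  split; [intros; now apply is_derive_on_of_is_derive|].
  split; [intros; now apply is_derive_on_of_is_derive|].
  split; [|split]; apply continuous_on_forall; intros x _; [| |apply C2];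
    apply (ex_derive_continuous (V := R_NormedModule));
    [exists (f1 x); apply H1 | exists (f2 x); apply H2].
Qed.

(** The real part of [(P - i Q) exp (i omega t)]. Real pairs replace complex amplitudes: a time
    derivative sends [(P, Q)] to [(omega Q, - omega P)], and a space derivative acts on each
    component. *)
Definition osc (omega : R) (P Q : R -> R) (t x : R) : R :=
  P x * cos (omega * t) + Q x * sin (omega * t).

Lemma osc_is_derive_t (omega : R) (P Q : R -> R) (t x : R) :
  is_derive (fun s => osc omega P Q s x) t
    (osc omega (fun y => omega * Q y) (fun y => - omega * P y) t x).
Proof. unfold osc; auto_derive; [easy|ring]. Qed.

Lemma osc_is_derive_x (omega : R) (P Q P1 Q1 : R -> R) (t x : R) :
  is_derive P x (P1 x) -> is_derive Q x (Q1 x) ->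
  is_derive (osc omega P Q t) x (osc omega P1 Q1 t x).
Proof.
  intros HP HQ; unfold osc.
  apply (is_derive_plus (V := R_NormedModule)
    (fun y => P y * cos (omega * t)) (fun y => Q y * sin (omega * t))).
  - generalize (is_derive_scal P x (cos (omega * t)) _ HP).
    rewrite (Rmult_comm _ (P1 x)); apply is_derive_ext.
    intros; apply (Rmult_comm _ (P _)).
  - generalize (is_derive_scal Q x (sin (omega * t)) _ HQ).
    rewrite (Rmult_comm _ (Q1 x)); apply is_derive_ext.
    intros; apply (Rmult_comm _ (Q _)).
Qed.

Lemma osc_is_dt (omega : R) (P Q : R -> R) :
  is_dt (osc omega P Q)
    (osc omega (fun y => omega * Q y) (fun y => - omega * P y)).
Proof.
  intros t x [Ht _]; apply is_derive_on_of_is_derive;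
    [exact Ht|apply osc_is_derive_t].
Qed.

Lemma osc_is_dx (omega : R) (P Q P1 Q1 : R -> R) :
  (forall x, is_derive P x (P1 x)) -> (forall x, is_derive Q x (Q1 x)) ->
  is_dx (osc omega P Q) (osc omega P1 Q1).
Proof.
  intros HP HQ t x [_ Hx]; apply is_derive_on_of_is_derive;
    [exact Hx|now apply osc_is_derive_x].
Qed.

Lemma osc_C0_strip (omega : R) (P Q : R -> R) :
  (forall x, continuous P x) -> (forall x, continuous Q x) ->
  C0_strip (osc omega P Q).
Proof.
  intros CP CQ.
  assert (Hx : forall h, (forall x, continuous h x) -> C0_strip (fun _ x => h x)).
  { intros h Ch; apply continuous_on_forall; intros p _.
    apply (continuous_comp snd h); [apply continuous_snd|apply Ch]. }
  assert (Ht : forall h, (forall x, ex_derive h x) -> C0_strip (fun t _ => h t)).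
  { intros h Ch; apply continuous_on_forall; intros p _.
    apply (continuous_comp fst h); [apply continuous_fst|].
    apply (ex_derive_continuous (V := R_NormedModule)), Ch. }
  apply C0_strip_plus; apply C0_strip_mult.
  - now apply Hx.
  - apply (Ht (fun t => cos (omega * t))); intros; auto_derive; easy.
  - now apply Hx.
  - apply (Ht (fun t => sin (omega * t))); intros; auto_derive; easy.
Qed.

(** The two algebraic hypotheses are the coefficients of [cos (omega t)] and [sin (omega t)] in the
    differential equation. *)
Lemma osc_is_solution (sigma mu omega : R) (P Q P1 Q1 P2 Q2 : R -> R) :
  (forall x, is_derive P x (P1 x)) -> (forall x, is_derive Q x (Q1 x)) ->
  (forall x, is_derive P1 x (P2 x)) -> (forall x, is_derive Q1 x (Q2 x)) ->
  (forall x, continuous P2 x) -> (forall x, continuous Q2 x) ->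
  (forall x, - omega ^ 2 * P x =
     P2 x + sigma * (omega * Q2 x) - mu * (omega * Q x)) ->
  (forall x, - omega ^ 2 * Q x =
     Q2 x - sigma * (omega * P2 x) + mu * (omega * P x)) ->
  P 0 = 1 -> Q 0 = 0 -> P 1 = 0 -> Q 1 = 0 ->
  is_solution sigma mu P (fun x => omega * Q x) (fun t => cos (omega * t))
    (osc omega P Q).
Proof.
  intros HP HQ HP1 HQ1 CP2 CQ2 E1 E2 P0 Q0 P1' Q1'.
  assert (Cd : forall h h1 : R -> R, (forall x, is_derive h x (h1 x)) ->
    forall x, continuous h x).
  { intros h h1 Hh x; apply (ex_derive_continuous (V := R_NormedModule)).
    exists (h1 x); apply Hh. }
  assert (Cs : forall (h : R -> R) c, (forall x, continuous h x) ->
    forall x, continuous (fun y => c * h y) x).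
  { intros h c Hh x; exact (continuous_scal_r (V := R_NormedModule) c h x (Hh x)). }
  assert (Ds : forall (h h1 : R -> R) c, (forall x, is_derive h x (h1 x)) ->
    forall x, is_derive (fun y => c * h y) x (c * h1 x)).
  { intros h h1 c Hh x; exact (is_derive_scal h x c _ (Hh x)). }
  assert (CP := Cd _ _ HP). assert (CQ := Cd _ _ HQ).
  assert (CP1 := Cd _ _ HP1). assert (CQ1 := Cd _ _ HQ1).
  set (v := osc omega (fun y => omega * Q y) (fun y => - omega * P y)).
  split; [|exists v; split; [|split; [|split; [|split]]]].
  - split; [now apply osc_C0_strip|].
    exists v, (osc omega P1 Q1); split; [apply osc_is_dt|].
    split; [now apply osc_is_dx|]; split.
    + split; [apply osc_C0_strip; now apply Cs|].
      eexists; eexists; split; [apply osc_is_dt|].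
      split; [apply osc_is_dx; apply Ds; [exact HQ1 || exact HQ|exact HP]|].
      split; apply osc_C0_strip; intros; repeat apply Cs; auto.
    + split; [now apply osc_C0_strip|].
      eexists; eexists; split; [apply osc_is_dt|].
      split; [apply osc_is_dx; [exact HP1|exact HQ1]|].
      split; apply osc_C0_strip; intros; repeat apply Cs; auto.
  - apply osc_is_dt.
  - intros t _.
    apply (C2_on_of_is_derive _ _
      (osc omega (fun y => omega * Q1 y) (fun y => - omega * P1 y) t)
      (osc omega (fun y => omega * Q2 y) (fun y => - omega * P2 y) t)).
    + intros x; apply osc_is_derive_x; now apply Ds.
    + intros x; apply osc_is_derive_x; now apply Ds.
    + intros x; unfold osc.
      apply (continuous_plus (V := R_NormedModule)).
      * apply (continuous_mult (K := R_AbsRing) (fun y => omega * Q2 y)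
          (fun _ => cos (omega * t))); [now apply Cs|apply continuous_const].
      * apply (continuous_mult (K := R_AbsRing) (fun y => - omega * P2 y)
          (fun _ => sin (omega * t))); [now apply Cs|apply continuous_const].
  - intros t x _ _.
    assert (D2 : forall H H1 H2 K K1 K2 : R -> R,
      (forall x, is_derive H x (H1 x)) -> (forall x, is_derive K x (K1 x)) ->
      (forall x, is_derive H1 x (H2 x)) -> (forall x, is_derive K1 x (K2 x)) ->
      Derive_n (osc omega H K t) 2 x = osc omega H2 K2 t x).
    { intros H H1 H2 K K1 K2 A1 A2 A3 A4; simpl.
      rewrite (Derive_ext _ (osc omega H1 K1 t)).
      - apply is_derive_unique; now apply osc_is_derive_x.
      - intros y; apply is_derive_unique; now apply osc_is_derive_x. }
    unfold v at 1.
    rewrite (is_derive_unique _ _ _ (osc_is_derive_t _ _ _ _ _)).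
    rewrite (D2 P P1 P2 Q Q1 Q2) by assumption.
    unfold v at 1.
    rewrite (D2 _ (fun y => omega * Q1 y) (fun y => omega * Q2 y)
      _ (fun y => - omega * P1 y) (fun y => - omega * P2 y)) by now apply Ds.
    unfold v, osc.
    replace (omega * (- omega * P x)) with (- omega ^ 2 * P x) by ring.
    replace (- omega * (omega * Q x)) with (- omega ^ 2 * Q x) by ring.
    rewrite E1, E2; ring.
  - intros t _; unfold osc; rewrite P0, Q0, P1', Q1'; split; ring.
  - intros x _; unfold v, osc; rewrite Rmult_0_r, cos_0, sin_0; split; ring.
Qed.

(** * Amplitude of an oscillation *)

(** [acos] reaches the upper half circle only; the lower half is its mirror image. *)
Lemma cos_sin_angle (c s : R) :
  c ^ 2 + s ^ 2 = 1 -> exists phi, cos phi = c /\ sin phi = s.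
Proof.
  intros H.
  assert (Hc : -1 <= c <= 1) by nra.
  assert (Hs : sqrt (1 - c²) = Rabs s).
  { replace (1 - c²) with (s²) by (unfold Rsqr; lra).
    apply sqrt_Rsqr_abs. }
  destruct (Rle_dec 0 s) as [Ps|Ns].
  - exists (acos c); rewrite cos_acos, sin_acos, Hs by exact Hc.
    split; [reflexivity|now apply Rabs_pos_eq].
  - exists (- acos c); rewrite cos_neg, sin_neg, cos_acos, sin_acos, Hs
      by exact Hc.
    split; [reflexivity|]; rewrite Rabs_left by lra; ring.
Qed.

(** With [P = rho cos phi] and [Q = rho sin phi] the oscillation is [rho cos (omega t - phi)], which
    equals [rho] whenever [omega t - phi] is a multiple of [2 PI]. *)
Lemma osc_attains_amplitude (omega : R) (P Q : R -> R) (x T : R) :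
  0 < omega ->
  exists t, T <= t /\ osc omega P Q t x = sqrt (P x ^ 2 + Q x ^ 2).
Proof.
  intros Hw; set (rho := sqrt (P x ^ 2 + Q x ^ 2)).
  assert (Hnn : 0 <= P x ^ 2 + Q x ^ 2) by nra.
  assert (Hrho : rho ^ 2 = P x ^ 2 + Q x ^ 2) by now apply pow2_sqrt.
  destruct (Req_dec rho 0) as [Z|NZ].
  - exists T; split; [lra|]; rewrite Z.
    rewrite Z in Hrho.
    assert (P x = 0) by nra. assert (Q x = 0) by nra.
    unfold osc; rewrite H, H0; ring.
  - destruct (cos_sin_angle (P x / rho) (Q x / rho)) as [phi [Hc Hs]].
    { replace ((P x / rho) ^ 2 + (Q x / rho) ^ 2)
        with ((P x ^ 2 + Q x ^ 2) / rho ^ 2) by (field; exact NZ).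
      rewrite <- Hrho; field; exact NZ. }
    (* The number of periods: [Rmax 0] makes the natural floor available, and [S n] pushes the time
       past [T]. *)
    destruct (nfloor_ex (Rmax 0 ((omega * T - phi) / (2 * PI)))) as [n [_ Hn]];
      [apply Rmax_l|].
    generalize PI_RGT_0; intros HPI.
    exists ((phi + 2 * INR (S n) * PI) / omega); split.
    + apply (Rmult_le_reg_l omega); [exact Hw|].
      replace (omega * ((phi + 2 * INR (S n) * PI) / omega))
        with (phi + INR (S n) * (2 * PI)) by (field; lra).
      rewrite S_INR.
      assert ((omega * T - phi) / (2 * PI) < INR n + 1)
        by (apply Rle_lt_trans with (2 := Hn), Rmax_r).
      apply Rmult_lt_compat_r with (r := 2 * PI) in H; [|lra].
      unfold Rdiv in H; rewrite Rmult_assoc, Rinv_l in H by lra; lra.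
    + unfold osc.
      replace (omega * ((phi + 2 * INR (S n) * PI) / omega))
        with (phi + 2 * INR (S n) * PI) by (field; lra).
      rewrite cos_period, sin_period, Hc, Hs.
      replace (P x * (P x / rho) + Q x * (Q x / rho))
        with ((P x ^ 2 + Q x ^ 2) / rho) by (field; exact NZ).
      rewrite <- Hrho; field; exact NZ.
Qed.

(** * Lower bounds for the limsup and the gain *)

Lemma Rbar_lub_correct (E : Rbar -> Prop) : Rbar_is_lub E (Rbar_lub E).
Proof. exact (proj2_sig (Rbar_ex_lub E)). Qed.

Lemma Rbar_glb_correct (E : Rbar -> Prop) : Rbar_is_glb E (Rbar_glb E).
Proof. exact (proj2_sig (Rbar_ex_glb E)). Qed.

(** Large values at a single point, recurring at arbitrarily late times, bound every tail supremum
    from below and hence their infimum. *)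
Lemma limsup_norm_ge (u : R -> R -> R) (x c : R) :
  unit_itv x -> (forall T, 0 <= T -> exists t, T <= t /\ c <= Rabs (u t x)) ->
  Rbar_le c (limsup_norm u).
Proof.
  intros Hx H; unfold limsup_norm, limsup_pinfty.
  apply (proj2 (Rbar_glb_correct _)); intros z [T [HT ->]].
  destruct (H T HT) as [t [Ht Hc]].
  apply Rbar_le_trans with (sup_norm unit_itv (u t)).
  - apply Rbar_le_trans with (Finite (Rabs (u t x))); [exact Hc|].
    apply (proj1 (Lub_Rbar_correct _)); now exists x.
  - apply (proj1 (Rbar_lub_correct _)); now exists t.
Qed.

Lemma sup_norm_cos (omega : R) :
  sup_norm half_line (fun t => cos (omega * t)) = 1.
Proof.
  apply is_lub_Rbar_unique; split.
  - intros y [t [_ ->]]; apply Rabs_le, COS_bound.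
  - intros b Hb; apply Hb; exists 0; split; [apply Rle_refl|].
    now rewrite Rmult_0_r, cos_0, Rabs_R1.
Qed.

Lemma gamma_infty_ge_amplitude (sigma mu omega : R)
    (P Q P1 Q1 P2 Q2 : R -> R) (x : R) :
  0 < sigma -> 0 <= mu -> 0 < omega ->
  (forall x, is_derive P x (P1 x)) -> (forall x, is_derive Q x (Q1 x)) ->
  (forall x, is_derive P1 x (P2 x)) -> (forall x, is_derive Q1 x (Q2 x)) ->
  (forall x, continuous P2 x) -> (forall x, continuous Q2 x) ->
  (forall x, - omega ^ 2 * P x =
     P2 x + sigma * (omega * Q2 x) - mu * (omega * Q x)) ->
  (forall x, - omega ^ 2 * Q x =
     Q2 x - sigma * (omega * P2 x) + mu * (omega * P x)) ->
  P 0 = 1 -> Q 0 = 0 -> P 1 = 0 -> Q 1 = 0 ->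
  unit_itv x ->
  Rbar_le (sqrt (P x ^ 2 + Q x ^ 2)) (gamma_infty sigma mu).
Proof.
  intros Hs Hm Hw HP HQ HP1 HQ1 CP2 CQ2 E1 E2 P0 Q0 P1' Q1' Hx.
  assert (Sol := osc_is_solution sigma mu omega P Q P1 Q1 P2 Q2
    HP HQ HP1 HQ1 CP2 CQ2 E1 E2 P0 Q0 P1' Q1').
  assert (HPhi : Phi sigma mu P (fun x => omega * Q x)
    (fun t => cos (omega * t))).
  { split; [|split].
    - apply (C2_on_of_is_derive _ _ (fun t => - omega * sin (omega * t))
        (fun t => - omega ^ 2 * cos (omega * t))).
      + intros t; auto_derive; [easy|ring].
      + intros t; auto_derive; [easy|ring].
      + intros t; apply (ex_derive_continuous (V := R_NormedModule)).
        auto_derive; easy.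
    - exists 1; intros t _; apply Rabs_le, COS_bound.
    - split; [now exists (osc omega P Q)|].
      intros u1 u2 S1 S2; now apply (is_solution_unique sigma mu P
        (fun x => omega * Q x) (fun t => cos (omega * t))). }
  apply Rbar_le_trans with (limsup_norm (osc omega P Q)).
  - apply (limsup_norm_ge _ x); [exact Hx|].
    intros T _; destruct (osc_attains_amplitude omega P Q x T Hw) as [t [Ht E]].
    exists t; split; [exact Ht|]; rewrite E; apply Rle_abs.
  - apply (proj1 (Rbar_lub_correct _)).
    exists P, (fun x => omega * Q x), (fun t => cos (omega * t)),
      (osc omega P Q).
    split; [|split; [exact HPhi|split; [|split; [exact Sol|]]]].
    + split; [now apply (C2_on_of_is_derive _ P P1 P2)|split].
      * apply (C2_on_of_is_derive _ _ (fun x => omega * Q1 x)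
          (fun x => omega * Q2 x)).
        -- intros y; exact (is_derive_scal Q y omega _ (HQ y)).
        -- intros y; exact (is_derive_scal Q1 y omega _ (HQ1 y)).
        -- intros y; exact (continuous_scal_r (V := R_NormedModule)
             omega Q2 y (CQ2 y)).
      * now exists (fun t => cos (omega * t)).
    + exists 0; split; [lra|]; rewrite Rmult_0_r, cos_0; lra.
    (* The limsup is an extended real, so division by 1 is checked at the infinite values too. *)
    + rewrite sup_norm_cos; unfold Rbar_div; simpl; rewrite Rinv_1.
      destruct (limsup_norm _) as [r| |]; simpl.
      * now rewrite Rmult_1_r.
      * destruct (Rle_dec 0 1) as [H|H]; [|lra].
        destruct (Rle_lt_or_eq_dec 0 1 H); [easy|lra].
      * destruct (Rle_dec 0 1) as [H|H]; [|lra].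
        destruct (Rle_lt_or_eq_dec 0 1 H); [easy|lra].
Qed.

(** * The characteristic exponent *)

(** [max_on] is an [iota], meaningful once exactly one maximum is known: existence is the extreme
    value theorem, uniqueness is antisymmetry. *)
Lemma max_on_unit_attained (F : R -> R) :
  (forall x, continuous F x) ->
  exists x, unit_itv x /\ F x = max_on unit_itv F.
Proof.
  intros CF.
  destruct (continuity_ab_maj F 0 1 Rle_0_1) as [x0 [Hmax Hx0]].
  { intros c _; apply continuity_pt_filterlim, CF. }
  assert (E : max_on unit_itv F = F x0).
  { apply (iota_unique (V := R_CompleteNormedModule)).
    - intros m [[x [Hx <-]] Hm]; apply Rle_antisym.
      + now apply Hmax.
      + now apply Hm.
    - split; [now exists x0|exact Hmax]. }
  exists x0; now rewrite E.
Qed.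

(** [D r] is the modulus of the vector [(c1, s1)], so the prescribed cosine and sine lie on the unit
    circle. As [s1 > 0], they lie on its open upper half, where [acos] gives the one angle that
    [iota] selects. *)
Lemma theta_of_spec (sigma mu omega : R) :
  0 < sigma -> 0 <= mu -> 0 < omega ->
  let D := 1 + sigma ^ 2 * omega ^ 2 in
  let r := r_of sigma mu omega in
  let theta := theta_of sigma mu omega in
  0 < r /\ 0 < theta < PI /\
  r * cos theta = (mu * sigma - 1) * omega ^ 2 / D /\
  r * sin theta = (mu + sigma * omega ^ 2) * omega / D.
Proof.
  intros Hs Hm Hw D r theta.
  assert (HD : 0 < D) by (unfold D; nra).
  assert (Hk : 0 < mu + sigma * omega ^ 2)
    by (apply Rplus_le_lt_0_compat, Rmult_lt_0_compat, pow_lt; assumption).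
  set (c1 := (mu * sigma - 1) * omega ^ 2).
  set (s1 := (mu + sigma * omega ^ 2) * omega).
  assert (Hs1 : 0 < s1) by (now apply Rmult_lt_0_compat).
  assert (Hrad : 0 < (mu * sigma - 1) ^ 2 * omega ^ 2
      + (mu + sigma * omega ^ 2) ^ 2).
  { apply Rplus_le_lt_0_compat.
    - rewrite <- Rpow_mult_distr; apply pow2_ge_0.
    - now apply pow_lt. }
  assert (Hr : 0 < r).
  { unfold r, r_of; apply Rdiv_lt_0_compat; [|exact HD].
    apply Rmult_lt_0_compat; [exact Hw|now apply sqrt_lt_R0]. }
  assert (HDr : 0 < D * r) by (now apply Rmult_lt_0_compat).
  assert (HDr2 : (D * r) ^ 2 = c1 ^ 2 + s1 ^ 2).
  { unfold r, r_of; fold D.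
    match goal with |- context [sqrt ?e] =>
      replace ((D * (omega * sqrt e / D)) ^ 2) with (omega ^ 2 * sqrt e ^ 2)
        by (field; lra);
      rewrite (pow2_sqrt e) by lra
    end.
    unfold c1, s1; ring. }
  assert (Hunit : (c1 / (D * r)) ^ 2 + (s1 / (D * r)) ^ 2 = 1).
  { transitivity ((c1 ^ 2 + s1 ^ 2) / (D * r) ^ 2); [field; lra|].
    rewrite <- HDr2; field; lra. }
  assert (Hsp : 0 < s1 / (D * r)) by (now apply Rdiv_lt_0_compat).
  assert (Hc : -1 < c1 / (D * r) < 1) by nra.
  assert (Hth : 0 < theta < PI /\ cos theta = c1 / (D * r) /\
      sin theta = s1 / (D * r)).
  { apply (iota_correct (V := R_CompleteNormedModule) (fun z : R =>
      0 < z < PI /\ cos z = c1 / (D * r) /\ sin z = s1 / (D * r))).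
    assert (Hsa : sin (acos (c1 / (D * r))) = s1 / (D * r)).
    { rewrite sin_acos by lra; rewrite <- (sqrt_Rsqr (s1 / (D * r))) by lra.
      f_equal; unfold Rsqr; lra. }
    exists (acos (c1 / (D * r))); split.
    - split; [|split; [apply cos_acos; lra|exact Hsa]].
      destruct (acos_bound (c1 / (D * r))) as [[H0|H0] [HPI|HPI]];
        [now split| | |]; exfalso.
      + rewrite HPI, sin_PI in Hsa; lra.
      + rewrite <- H0, sin_0 in Hsa; lra.
      + rewrite <- H0, sin_0 in Hsa; lra.
    - intros z [Hz [Hcz _]]; rewrite <- Hcz; apply acos_cos; lra. }
  destruct Hth as [Hb [Hcos Hsin]].
  split; [exact Hr|split; [exact Hb|]].
  rewrite Hcos, Hsin; split; field; split; lra.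
Qed.

(* [(a + i b)^2 = (- omega^2 + i mu omega) / (1 + i sigma omega)], the
   characteristic equation of the modes [exp (i omega t + (a + i b) x)]. *)
Lemma a_of_b_of_spec (sigma mu omega : R) :
  0 < sigma -> 0 <= mu -> 0 < omega ->
  let a := a_of sigma mu omega in
  let b := b_of sigma mu omega in
  0 < a /\
  (a ^ 2 - b ^ 2) - sigma * omega * (2 * a * b) = - omega ^ 2 /\
  2 * a * b + sigma * omega * (a ^ 2 - b ^ 2) = mu * omega.
Proof.
  intros Hs Hm Hw a b.
  destruct (theta_of_spec sigma mu omega Hs Hm Hw) as [Hr [Hb [Hc Hsn]]].
  assert (HD : 0 < 1 + sigma ^ 2 * omega ^ 2) by nra.
  assert (Ha : 0 < a).
  { apply Rmult_lt_0_compat; [now apply sqrt_lt_R0|apply cos_gt_0; lra]. }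
  (* [a + i b] is a square root of [r exp (i theta)]; the double-angle formulas give the real and
     imaginary parts of its square. *)
  assert (Hre : a ^ 2 - b ^ 2
      = (mu * sigma - 1) * omega ^ 2 / (1 + sigma ^ 2 * omega ^ 2)).
  { rewrite <- Hc; unfold a, b, a_of, b_of.
    rewrite !Rpow_mult_distr, pow2_sqrt by lra.
    replace (theta_of sigma mu omega) with (2 * (theta_of sigma mu omega / 2))
      at 3 by field.
    rewrite cos_2a; ring. }
  assert (Him : 2 * a * b
      = (mu + sigma * omega ^ 2) * omega / (1 + sigma ^ 2 * omega ^ 2)).
  { rewrite <- Hsn; unfold a, b, a_of, b_of.
    replace (theta_of sigma mu omega) with (2 * (theta_of sigma mu omega / 2))
      at 3 by field.
    rewrite sin_2a.
    rewrite <- (sqrt_sqrt (r_of sigma mu omega)) at 3 by lra; ring. }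
  split; [exact Ha|]; rewrite Hre, Him; split; field; lra.
Qed.

(** The left side is [|sinh ((a + i b) y)|^2]. In terms of [p = exp (a y)] and [q = exp (- a y)] the
    identity reduces to [p q = 1]. *)
Lemma sinh_complex_modulus (a b y : R) :
  (sinh (a * y) * cos (b * y)) ^ 2 + (cosh (a * y) * sin (b * y)) ^ 2
  = (cosh (2 * a * y) - cos (2 * b * y)) / 2.
Proof.
  replace (2 * a * y) with (a * y + a * y) by ring.
  replace (2 * b * y) with (2 * (b * y)) by ring.
  rewrite cos_2a.
  assert (Hcs : cos (b * y) ^ 2 = 1 - sin (b * y) ^ 2)
    by (generalize (sin2_cos2 (b * y)); unfold Rsqr; lra).
  unfold sinh, cosh.
  rewrite Ropp_plus_distr, !exp_plus.
  assert (He : exp (a * y) * exp (- (a * y)) = 1)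
    by (rewrite <- exp_plus, Rplus_opp_r; apply exp_0).
  set (p := exp (a * y)) in *; set (q := exp (- (a * y))) in *.
  set (s := sin (b * y)) in *; set (c := cos (b * y)) in *.
  transitivity (((p - q) ^ 2 * c ^ 2 + (p + q) ^ 2 * s ^ 2) / 4); [field|].
  replace (c * c - s * s) with (c ^ 2 - s ^ 2) by ring.
  rewrite Hcs.
  transitivity ((p * p + q * q - 2 * (p * q) + 4 * (p * q) * s ^ 2) / 4);
    [field|].
  rewrite He; field.
Qed.

Lemma gamma_infty_ge_profile (sigma mu omega a b y : R) :
  0 < sigma -> 0 <= mu -> 0 < omega -> 0 < a ->
  (a ^ 2 - b ^ 2) - sigma * omega * (2 * a * b) = - omega ^ 2 ->
  2 * a * b + sigma * omega * (a ^ 2 - b ^ 2) = mu * omega ->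
  unit_itv y ->
  Rbar_le (sqrt ((cosh (2 * a * y) - cos (2 * b * y))
                 / (cosh (2 * a) - cos (2 * b))))
    (gamma_infty sigma mu).
Proof.
  intros Hs Hm Hw Ha Hre Him Hy.
  (* [sinh (k z) = S z + i T z] and [cosh (k z) = U z + i V z]
     for [k = a + i b]; [P - i Q] is the profile
     [sinh (k (1 - x)) / sinh k]. *)
  pose (S := fun z => sinh (a * z) * cos (b * z)).
  pose (T := fun z => cosh (a * z) * sin (b * z)).
  pose (U := fun z => cosh (a * z) * cos (b * z)).
  pose (V := fun z => sinh (a * z) * sin (b * z)).
  set (N := S 1 ^ 2 + T 1 ^ 2).
  assert (HN : N = (cosh (2 * a) - cos (2 * b)) / 2).
  { unfold N, S, T; rewrite sinh_complex_modulus, !Rmult_1_r; reflexivity. }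
  assert (Hmod : forall z, S z ^ 2 + T z ^ 2
      = (cosh (2 * a * z) - cos (2 * b * z)) / 2)
    by (intros; apply sinh_complex_modulus).
  (* [sinh k] is nonzero: [a > 0] gives [cosh (2 a) > 1], seen by writing [cosh (2 a) - 1] as a
     square over a positive number. *)
  assert (HNp : 0 < N).
  { rewrite HN; generalize (COS_bound (2 * b)); intros Hb.
    assert (1 < cosh (2 * a)); [|lra].
    assert (He := exp_increasing 0 (2 * a) ltac:(lra)); rewrite exp_0 in He.
    unfold cosh; rewrite exp_Ropp.
    assert (0 < (exp (2 * a) - 1) ^ 2 / (2 * exp (2 * a))).
    { apply Rdiv_lt_0_compat; [apply pow_lt|]; lra. }
    replace ((exp (2 * a) + / exp (2 * a)) / 2)
      with (1 + (exp (2 * a) - 1) ^ 2 / (2 * exp (2 * a))) by (field; lra).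
    lra. }
  (* [al - i be] is [1 / sinh k]. *)
  pose (al := S 1 / N). pose (be := T 1 / N).
  pose (P := fun x => al * S (1 - x) + be * T (1 - x)).
  pose (Q := fun x => be * S (1 - x) - al * T (1 - x)).
  (* [re + i im] is [k^2], by which two space derivatives multiply the profile; [P1 - i Q1] below is
     [- k cosh (k (1 - x)) / sinh k]. *)
  pose (re := a ^ 2 - b ^ 2). pose (im := 2 * a * b).
  pose (P1 := fun x => - (al * (a * U (1 - x) - b * V (1 - x))
    + be * (a * V (1 - x) + b * U (1 - x)))).
  pose (Q1 := fun x => - (be * (a * U (1 - x) - b * V (1 - x))
    - al * (a * V (1 - x) + b * U (1 - x)))).
  assert (Dsinh : forall z, is_derive sinh z (cosh z))
    by (intros; apply is_derive_Reals, derivable_pt_lim_sinh).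
  assert (Dcosh : forall z, is_derive cosh z (sinh z))
    by (intros; apply is_derive_Reals, derivable_pt_lim_cosh).
  assert (Esinh : forall z, Derive (fun z => sinh z) z = cosh z)
    by (intros; apply is_derive_unique, Dsinh).
  assert (Ecosh : forall z, Derive (fun z => cosh z) z = sinh z)
    by (intros; apply is_derive_unique, Dcosh).
  assert (HP : forall x, is_derive P x (P1 x)).
  { intros x; unfold P, P1, S, T, U, V; auto_derive.
    - repeat split; eexists; (apply Dsinh || apply Dcosh).
    - rewrite ?Esinh, ?Ecosh; unfold Rminus; ring. }
  assert (HQ : forall x, is_derive Q x (Q1 x)).
  { intros x; unfold Q, Q1, S, T, U, V; auto_derive.
    - repeat split; eexists; (apply Dsinh || apply Dcosh).
    - rewrite ?Esinh, ?Ecosh; unfold Rminus; ring. }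
  assert (HP1 : forall x, is_derive P1 x (re * P x + im * Q x)).
  { intros x; unfold P1, P, Q, re, im, S, T, U, V; auto_derive.
    - repeat split; eexists; (apply Dsinh || apply Dcosh).
    - rewrite ?Esinh, ?Ecosh; unfold Rminus; ring. }
  assert (HQ1 : forall x, is_derive Q1 x (re * Q x - im * P x)).
  { intros x; unfold Q1, P, Q, re, im, S, T, U, V; auto_derive.
    - repeat split; eexists; (apply Dsinh || apply Dcosh).
    - rewrite ?Esinh, ?Ecosh; unfold Rminus; ring. }
  assert (DP : forall x, ex_derive P x) by (intros x; exists (P1 x); apply HP).
  assert (DQ : forall x, ex_derive Q x) by (intros x; exists (Q1 x); apply HQ).
  (* At the reflected point [1 - y] the numerator of the profile is [sinh (k y)]. *)
  assert (Hamp : P (1 - y) ^ 2 + Q (1 - y) ^ 2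
      = (cosh (2 * a * y) - cos (2 * b * y)) / (cosh (2 * a) - cos (2 * b))).
  { unfold P, Q; replace (1 - (1 - y)) with y by ring.
    transitivity ((S y ^ 2 + T y ^ 2) * ((S 1 ^ 2 + T 1 ^ 2) / N ^ 2));
      [unfold al, be; field; lra|].
    fold N; rewrite Hmod.
    replace (cosh (2 * a) - cos (2 * b)) with (2 * N) by lra.
    field; lra. }
  assert (Z0 : S 0 = 0) by (unfold S; rewrite Rmult_0_r, sinh_0; ring).
  assert (T0 : T 0 = 0) by (unfold T; rewrite !Rmult_0_r, sin_0; ring).
  rewrite <- Hamp.
  apply (gamma_infty_ge_amplitude sigma mu omega P Q P1 Q1
    (fun x => re * P x + im * Q x) (fun x => re * Q x - im * P x));
    try assumption.
  - intros x; apply (ex_derive_continuous (V := R_NormedModule)).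
    auto_derive; auto.
  - intros x; apply (ex_derive_continuous (V := R_NormedModule)).
    auto_derive; auto.
  (* The first characteristic identity matches the coefficient of [P], the second cancels that of
     [Q]; in the next equation the roles are exchanged. *)
  - intros x; rewrite <- Hre; fold re im.
    transitivity (re * P x + im * Q x + sigma * omega * (re * Q x - im * P x)
      - (im + sigma * omega * re) * Q x); [ring|].
    unfold re, im; rewrite Him; ring.
  - intros x; rewrite <- Hre; fold re im.
    transitivity (re * Q x - im * P x - sigma * omega * (re * P x + im * Q x)
      + (im + sigma * omega * re) * P x); [ring|].
    unfold re, im; rewrite Him; ring.
  - unfold P; rewrite Rminus_0_r.
    transitivity ((S 1 ^ 2 + T 1 ^ 2) / N); [unfold al, be; field; lra|].
    fold N; field; lra.
  - unfold Q, al, be; rewrite Rminus_0_r; field; lra.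
  - unfold P; rewrite Rminus_diag, Z0, T0; ring.
  - unfold Q; rewrite Rminus_diag, Z0, T0; ring.
  - unfold unit_itv in *; lra.
Qed.

Theorem theorem2p4 (sigma mu : R) (hsigma : 0 < sigma) (hmu : 0 <= mu)
  (hgain : exists gamma : R, 0 <= gamma /\
     forall f g d : R -> R, X sigma mu f g -> Phi sigma mu f g d ->
     forall u : R -> R -> R, is_solution sigma mu f g d u ->
       Rbar_le (limsup_norm u)
         (Rbar_mult (Finite gamma) (sup_norm half_line d))) :
  Rbar_le
    (Lub_Rbar (fun y => exists omega : R, 0 < omega /\
       let a := a_of sigma mu omega in
       let b := b_of sigma mu omega in
       y = sqrt (max_on unit_itv (fun x => cosh (2 * a * x) - cos (2 * b * x))
                 / (cosh (2 * a) - cos (2 * b)))))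
    (gamma_infty sigma mu).
Proof.
  apply (proj2 (Lub_Rbar_correct _)).
  intros y [omega [Hw ->]].
  set (a := a_of sigma mu omega); set (b := b_of sigma mu omega).
  destruct (a_of_b_of_spec sigma mu omega hsigma hmu Hw) as [Ha [Hre Him]].
  destruct (max_on_unit_attained
    (fun x => cosh (2 * a * x) - cos (2 * b * x))) as [x [Hx <-]].
  { intros x; apply (ex_derive_continuous (V := R_NormedModule)).
    unfold cosh; auto_derive; easy. }
  exact (gamma_infty_ge_profile sigma mu omega a b x
    hsigma hmu Hw Ha Hre Him Hx).
Qed.
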